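(* Let $A\in\mathbb{C}^{n\times n}$ have index $k$ with $r(A^k)=t$, and let $m$ be a positive integer. Let $B\in\mathbb{C}^{n\times(n-t)}$ and $C^*\in\mathbb{C}^{n\times(n-t)}$ be of full column rank such that $\mathcal{R}(B)=\mathcal{N}((A^k)^*A^{m+1}A^\dagger)$ and $\mathcal{N}(C)=\mathcal{R}(A^k)$. Then the bordered matrix $$K=\begin{bmatrix}A&B\\C&0\end{bmatrix}$$ is nonsingular and its inverse is $$K^{-1}=\begin{bmatrix}A^{\mathrm{w}_m,\dagger}&(I_n-A^{\mathrm{w}_m,\dagger}A)C^\dagger\\ B^\dagger(I_n-AA^{\mathrm{w}_m,\dagger})&B^\dagger(AA^{\mathrm{w}_m,\dagger}A-A)C^\dagger\end{bmatrix}.$$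
   Context: $r(\cdot)$, $\mathcal{R}(\cdot)$, $\mathcal{N}(\cdot)$, $(\cdot)^*$ denote rank, range, null space and conjugate transpose; $(\cdot)^\dagger$ is the Moore-Penrose inverse and $A^D$ the Drazin inverse. The index of $A\in\mathbb{C}^{n\times n}$ is the smallest nonnegative integer $k$ with $r(A^{k+1})=r(A^k)$ (with $A^0=I_n$). For $A$ of index $k$, the core-EP inverse is $A^{\mathrm{cEP}}=A^DA^k(A^k)^\dagger$ and the $m$-weak group inverse is $A^{\mathrm{w}_m}=(A^{\mathrm{cEP}})^{m+1}A^m$. The $m$-weak group MP inverse $A^{\mathrm{w}_m,\dagger}$ is the unique $X\in\mathbb{C}^{n\times n}$ satisfying $XAX=X$, $AX=A_1A^\dagger$ and $XA=A^DA_1$, where $A_1=AA^{\mathrm{w}_m}A$. *)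

(* Defs.v *)
From HB Require Import structures.
From mathcomp Require Import all_boot all_order all_algebra.
From mathcomp Require Import classical_sets reals complex.
Set Implicit Arguments.
Unset Strict Implicit.
Unset Printing Implicit Defensive.
Import Order.TTheory GRing.Theory Num.Theory.
Local Open Scope classical_set_scope.
Local Open Scope ring_scope.
Local Open Scope sesquilinear_scope.

(* Range and null space are sets of column vectors: the row-space relations
   (_ <= _)%MS of mxalgebra would describe the transposed spaces. *)
Definition mxrange (F : fieldType) m n (A : 'M[F]_(m, n)) : set 'cV[F]_m :=
  [set y | exists x : 'cV[F]_n, y = A *m x].

Definition mxnull (F : fieldType) m n (A : 'M[F]_(m, n)) : set 'cV[F]_n :=
  [set x | A *m x = 0].

Lemma mxindex_exists (F : fieldType) n (A : 'M[F]_n) :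
  exists k, \rank (A ^+ k.+1) == \rank (A ^+ k).
Proof.
case: (boolP [exists k : 'I_n.+1, \rank (A ^+ k.+1) == \rank (A ^+ k)]).
  by move=> /existsP[k Hk]; exists k.
rewrite negb_exists => /forallP H.
have Hs k : (k <= n.+1)%N -> (\rank (A ^+ k) + k <= n)%N.
  elim: k => [|k IH] lekn; first by rewrite addn0 rank_leq_row.
  apply: leq_trans (IH (ltnW lekn)); rewrite addnS -addSn leq_add2r ltn_neqAle.
  by rewrite (H (Ordinal lekn)) exprS mxrankM_maxr.
by have := leq_trans (leq_addl _ _) (Hs n.+1 (leqnn _)); rewrite ltnn.
Qed.

Definition mxindex (F : fieldType) n (A : 'M[F]_n) : nat :=
  ex_minn (mxindex_exists A).

Lemma mxindex_rank (F : fieldType) n (A : 'M[F]_n) :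
  \rank (A ^+ (mxindex A).+1) = \rank (A ^+ mxindex A).
Proof. by rewrite /mxindex; case: ex_minnP => k /eqP. Qed.

Definition is_drazin (F : fieldType) n (A X : 'M[F]_n) : bool :=
  [&& A ^+ (mxindex A).+1 *m X == A ^+ mxindex A,
      X *m A *m X == X & A *m X == X *m A].

Lemma drazin_exists (F : fieldType) n (A : 'M[F]_n) :
  exists X, is_drazin A X.
Proof.
set k := mxindex A.
have rk j : \rank (A ^+ (j + k)) = \rank (A ^+ k).
  elim: j => [//|j IH]; apply/eqP; rewrite eqn_leq; apply/andP; split.
    by rewrite exprD mxrankM_maxr.
  have := mxrank_Frobenius (A ^+ j) (A ^+ k) A.
  have -> : A ^+ j *m A ^+ k = A ^+ (j + k) by rewrite exprD.
  have -> : A ^+ k *m A = A ^+ k.+1 by rewrite exprSr.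
  have -> : A ^+ (j + k) *m A = A ^+ (j.+1 + k) by rewrite addSn exprSr.
  by rewrite IH mxindex_rank -/k leq_add2l.
pose M := A ^+ (k.+1 + k); pose G := pinvmx M.
have MGM : M *m G *m M = M by rewrite mulmxKpV.
have rM : \rank M = \rank (A ^+ k) by rewrite rk.
have [W WM] : exists W, A ^+ k = W *m M.
  apply/submxP; have sM : (M <= A ^+ k)%MS by rewrite /M exprD submxMl.
  by have [_] := mxrank_leqif_sup sM; rewrite rM eqxx.
have [Z MZ] : exists Z, A ^+ k = M *m Z.
  have sM : (M^T <= (A ^+ k)^T)%MS.
    by rewrite /M addnC exprD trmx_mul submxMl.
  have [_] := mxrank_leqif_sup sM; rewrite !mxrank_tr rM eqxx.
  move=> /esym /submxP[D] /(congr1 trmx).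
  by rewrite trmxK trmx_mul trmxK; exists D^T.
move: MGM WM MZ; rewrite !mulmxE => MGM WM MZ.
have MA : M = A ^+ k.+1 * A ^+ k by rewrite -exprD.
have cMA : M * A = A * M by rewrite -exprS -exprSr.
clearbody G M.
have P1 : A ^+ k.+1 * (A ^+ k * G * A ^+ k) = A ^+ k.
  by rewrite !mulrA -MA {1}MZ !mulrA MGM -MZ.
have L : A ^+ k * G * A ^+ k = W * A ^+ k.
  by rewrite {1}WM {1}MZ -!mulrA (mulrA M G) (mulrA _ M) MGM -MZ.
have R : A ^+ k * G * A ^+ k = A ^+ k * Z.
  by rewrite L {1}MZ mulrA -WM.
have cX : A * (A ^+ k * G * A ^+ k) = A ^+ k * G * A ^+ k * A.
  rewrite {1}R L -(mulrA W) -exprSr exprS {2}MZ mulrA -exprS exprSr {1}WM.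
  by rewrite -!mulrA (mulrA M A) cMA !mulrA.
exists (A ^+ k * G * A ^+ k); rewrite /is_drazin !mulmxE -/k P1 cX !eqxx andbT.
by rewrite -(mulrA (A ^+ k * G)) -exprSr -mulrA P1 eqxx.
Qed.

Definition drazin (F : fieldType) n (A : 'M[F]_n) : 'M[F]_n :=
  xchoose (drazin_exists A).

Lemma drazinP (F : fieldType) n (A : 'M[F]_n) : is_drazin A (drazin A).
Proof. exact: xchooseP. Qed.

Lemma drazin_unique (F : fieldType) n (A X Y : 'M[F]_n) :
  is_drazin A X -> is_drazin A Y -> X = Y.
Proof.
rewrite /is_drazin !mulmxE.
move=> /and3P[/eqP X1 /eqP X2 /eqP X3] /and3P[/eqP Y1 /eqP Y2 /eqP Y3].
set k := mxindex A in X1 Y1.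
have pwl j : X = X ^+ j.+1 * A ^+ j.
  elim: j => [|j IH]; first by rewrite expr0 expr1 mulr1.
  rewrite [X ^+ _.+2]exprS [A ^+ _.+1]exprSr mulrA -(mulrA X) -IH.
  by rewrite -mulrA -X3 mulrA X2.
have pwr j : Y = A ^+ j * Y ^+ j.+1.
  elim: j => [|j IH]; first by rewrite expr0 expr1 mul1r.
  rewrite [A ^+ _.+1]exprS [Y ^+ _.+2]exprSr !mulrA -(mulrA A) -IH.
  by rewrite Y3 Y2.
have X1' : X * A ^+ k.+1 = A ^+ k.
  by rewrite -X1; apply: commrX; exact/esym.
have -> : X = X * A * Y.
  by rewrite [LHS](pwl k) -Y1 [A ^+ _.+1]exprSr !mulrA -pwl.
rewrite [RHS](pwr k) -X1' [A ^+ _.+1]exprS !mulrA -(mulrA (X * A)).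
by rewrite -pwr.
Qed.

Lemma gram_unit (C : numClosedFieldType) m n (A : 'M[C]_(m, n)) :
  row_free A -> A *m A^t* \in unitmx.
Proof.
move=> fA; rewrite -row_free_unit -kermx_eq0;
apply/eqP/row_matrixP => i.
rewrite row0; set x := row i _.
have x0 : x *m (A *m A^t*) = 0 by rewrite -row_mul mulmx_ker row0.
suff /eqP : x *m A = 0 by rewrite mulmx_free_eq0 // => /eqP.
apply/eqP; apply: contraT => /dotmx_is_dotmx.
rewrite dotmxE trmx_mul map_mxM !mulmxA -(mulmxA x) x0 mul0mx mxE.
by rewrite ltxx.
Qed.

Definition is_mpinv (C : numClosedFieldType) m n (A : 'M[C]_(m, n))
    (X : 'M[C]_(n, m)) : bool :=
  [&& A *m X *m A == A, X *m A *m X == X,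
      (A *m X)^t* == A *m X & (X *m A)^t* == X *m A].

Lemma trmxC_mul (C : numClosedFieldType) m n p (A : 'M[C]_(m, n))
    (B : 'M[C]_(n, p)) : (A *m B)^t* = B^t* *m A^t*.
Proof. by rewrite trmx_mul map_mxM. Qed.

Lemma trmxC_inv (C : numClosedFieldType) n (A : 'M[C]_n) :
  (invmx A)^t* = invmx (A^t*).
Proof. by rewrite trmx_inv map_invmx. Qed.

Lemma mpinv_exists (C : numClosedFieldType) m n (A : 'M[C]_(m, n)) :
  exists X, is_mpinv A X.
Proof.
have := (esym (mulmx_base A), col_base_full A, row_base_free A).
move: (\rank A) (col_base A) (row_base A) => r L R [[AE fL] fR].
have uR : R *m R^t* \in unitmx by exact: gram_unit.
have uL : L^t* *m L \in unitmx.
  rewrite -{2}[L]trmxCK gram_unit //.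
  by rewrite /row_free mxrank_map mxrank_tr.
pose S := R^t* *m invmx (R *m R^t*); pose T := invmx (L^t* *m L) *m L^t*.
have RS : R *m S = 1%:M by rewrite mulmxA mulmxV.
have TL : T *m L = 1%:M by rewrite -mulmxA mulVmx.
have AX : A *m (S *m T) = L *m T by rewrite AE mulmxA -(mulmxA L) RS mulmx1.
have XA : S *m T *m A = S *m R by rewrite AE mulmxA -(mulmxA S) TL mulmx1.
exists (S *m T); rewrite /is_mpinv AX XA; apply/and4P; split; apply/eqP.
- by rewrite {1}AE mulmxA -(mulmxA L) TL mulmx1 -AE.
- by rewrite mulmxA -(mulmxA S) RS mulmx1.
- by rewrite /T !trmxC_mul trmxC_inv !trmxC_mul !trmxCK mulmxA.
- by rewrite /S !trmxC_mul trmxC_inv !trmxC_mul !trmxCK mulmxA.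
Qed.

Definition mpinv (C : numClosedFieldType) m n (A : 'M[C]_(m, n)) :
  'M[C]_(n, m) := xchoose (mpinv_exists A).

Lemma mpinvP (C : numClosedFieldType) m n (A : 'M[C]_(m, n)) :
  is_mpinv A (mpinv A).
Proof. exact: xchooseP. Qed.

Lemma mpinv_unique (C : numClosedFieldType) m n (A : 'M[C]_(m, n))
    (X Y : 'M[C]_(n, m)) :
  is_mpinv A X -> is_mpinv A Y -> X = Y.
Proof.
move=> /and4P[/eqP X1 /eqP X2 /eqP X3 /eqP X4].
move=> /and4P[/eqP Y1 /eqP Y2 /eqP Y3 /eqP Y4].
have AXY : A *m X = A *m Y.
  by rewrite -X3 -{1}Y1 -(mulmxA (A *m Y)) trmxC_mul X3 Y3 mulmxA X1.
have XYA : X *m A = Y *m A.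
  by rewrite -X4 -{1}Y1 -(mulmxA A) mulmxA trmxC_mul X4 Y4 -mulmxA
    (mulmxA A) X1.
by rewrite -X2 XYA -mulmxA AXY mulmxA Y2.
Qed.

Definition core_ep (C : numClosedFieldType) n (A : 'M[C]_n) : 'M[C]_n :=
  drazin A *m A ^+ mxindex A *m mpinv (A ^+ mxindex A).

Definition m_weak_group (C : numClosedFieldType) n (m : nat)
    (A : 'M[C]_n) : 'M[C]_n :=
  core_ep A ^+ m.+1 *m A ^+ m.

Definition is_m_weak_group_mp (C : numClosedFieldType) n (m : nat)
    (A X : 'M[C]_n) : bool :=
  let A1 := A *m m_weak_group m A *m A in
  [&& X *m A *m X == X, A *m X == A1 *m mpinv A & X *m A == drazin A *m A1].

Lemma core_ep_outer (C : numClosedFieldType) n (A : 'M[C]_n) :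
  core_ep A *m A *m core_ep A = core_ep A.
Proof.
rewrite /core_ep; set k := mxindex A; set D := drazin A; set P := mpinv _.
have /and3P[/eqP D1 /eqP D2 /eqP D3] := drazinP A; rewrite -/k -/D in D1 D2 D3.
have /and4P[_ /eqP P2 _ _] := mpinvP (A ^+ k); rewrite -/P in P2.
have DA : A *m (D *m A ^+ k) = A ^+ k.
  have c : D *m A ^+ k = A ^+ k *m D by apply: commrX; exact/esym.
  by rewrite c mulmxA [A *m _](_ : _ = A ^+ k.+1) // exprS.
rewrite -!mulmxA (mulmxA D (A ^+ k) P) (mulmxA A) DA.
by rewrite (mulmxA P) P2 mulmxA.
Qed.

Lemma mul_core_ep2 (C : numClosedFieldType) n (A : 'M[C]_n) :
  A *m (core_ep A *m core_ep A) = core_ep A.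
Proof.
rewrite /core_ep; set k := mxindex A; set D := drazin A; set P := mpinv _.
have /and3P[/eqP D1 /eqP D2 /eqP D3] := drazinP A; rewrite -/k -/D in D1 D2 D3.
have /and4P[/eqP P1 _ _ _] := mpinvP (A ^+ k); rewrite -/P in P1.
have c : D *m A ^+ k = A ^+ k *m D by apply: commrX; exact/esym.
have DA : A *m (D *m A ^+ k) = A ^+ k.
  by rewrite c mulmxA [A *m _](_ : _ = A ^+ k.+1) // exprS.
rewrite mulmxA (mulmxA A (D *m _)) DA c -!mulmxA.
by rewrite (mulmxA P) (mulmxA (A ^+ k)) (mulmxA (A ^+ k)) P1.
Qed.

Lemma mul_core_epX (C : numClosedFieldType) n (A : 'M[C]_n) j :
  A ^+ j.+1 *m core_ep A ^+ j.+1 = A *m core_ep A.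
Proof.
move: (mul_core_ep2 A); rewrite !mulmxE; move: (core_ep A) => c e.
elim: j => [|j IH]; first by rewrite !expr1.
rewrite [A ^+ _.+2]exprSr [c ^+ j.+2]exprS [c ^+ j.+1]exprS -mulrA.
by rewrite (mulrA c) (mulrA A) e -exprS.
Qed.

Lemma drazin_mul_core_ep (C : numClosedFieldType) n (A : 'M[C]_n) :
  drazin A *m A *m core_ep A = core_ep A.
Proof.
have /and3P[_ /eqP D2 _] := drazinP A.
by rewrite /core_ep !mulmxA D2.
Qed.

Lemma m_weak_group_outer (C : numClosedFieldType) n m (A : 'M[C]_n) :
  m_weak_group m A *m A *m m_weak_group m A = m_weak_group m A.
Proof.
move: (core_ep_outer A) (mul_core_epX A m); rewrite /m_weak_group !mulmxE.
move: (core_ep A) => c e p.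
rewrite -(mulrA _ (A ^+ m) A) -exprSr !mulrA -(mulrA _ (A ^+ m.+1)) p.
by rewrite [in LHS]exprSr !mulrA -(mulrA _ c A) -(mulrA _ (c * A)) e -exprSr.
Qed.

Lemma m_weak_group_mpE (C : numClosedFieldType) n m (A : 'M[C]_n) :
  is_m_weak_group_mp m A (m_weak_group m A *m A *m mpinv A).
Proof.
rewrite /is_m_weak_group_mp /=; set W := m_weak_group m A.
have /and4P[/eqP P1 _ _ _] := mpinvP A.
have o : W *m A *m W = W by exact: m_weak_group_outer.
have d : drazin A *m A *m W = W.
  rewrite /W /m_weak_group mulmxA [core_ep A ^+ _]exprS -mulmxE.
  by rewrite mulmxA drazin_mul_core_ep.
move: W o d => W o d; apply/and3P; split; apply/eqP; last first.
- rewrite -(mulmxA _ (mpinv A) A) -(mulmxA W A) (mulmxA A (mpinv A)) P1.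
  by rewrite !mulmxA d.
- by rewrite !mulmxA.
by rewrite -(mulmxA W A) -(mulmxA W) P1 !mulmxA o.
Qed.

Lemma m_weak_group_mp_exists (C : numClosedFieldType) n m (A : 'M[C]_n) :
  exists X, is_m_weak_group_mp m A X.
Proof. by eexists; exact: m_weak_group_mpE. Qed.

Lemma m_weak_group_mp_unique (C : numClosedFieldType) n m (A X Y : 'M[C]_n) :
  is_m_weak_group_mp m A X -> is_m_weak_group_mp m A Y -> X = Y.
Proof.
move=> /and3P[/eqP X1 /eqP X2 /eqP X3] /and3P[/eqP Y1 /eqP Y2 /eqP Y3].
by rewrite -X1 X3 -Y3 -mulmxA X2 -Y2 mulmxA Y1.
Qed.

Definition m_weak_group_mp (C : numClosedFieldType) n (m : nat)
    (A : 'M[C]_n) : 'M[C]_n :=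
  xchoose (m_weak_group_mp_exists m A).

Lemma m_weak_group_mpP (C : numClosedFieldType) n m (A : 'M[C]_n) :
  is_m_weak_group_mp m A (m_weak_group_mp m A).
Proof. exact: xchooseP. Qed.

(* Main.v *)
Require Import Defs.
From HB Require Import structures.
From mathcomp Require Import all_boot all_order all_algebra.
From mathcomp Require Import classical_sets reals complex.
Set Implicit Arguments.
Unset Strict Implicit.
Unset Printing Implicit Defensive.
Import Order.TTheory GRing.Theory Num.Theory.
Local Open Scope ring_scope.
Local Open Scope sesquilinear_scope.

(** Both matrices are square, so it is enough that the claimed inverse [Y] is a
    right inverse of the bordered matrix [K].  Write [X] for the m-weak group MP inverse.  Blockwise,
    [K *m Y = 1] amounts to three facts:
    - [C *m X = 0], because [X] starts with a core-EP inverse, whose range lies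
      in that of [A ^+ k], the null space of [C] ([core_ep_factor]);
    - [C *m mpinv C = 1%:M], because [C] has full row rank
      ([mulmx_mpinv_row_free]);
    - [B *m mpinv B] fixes [1%:M - A *m X], because the columns of the latter lie
      in the range of [B].
    For the third one, [A *m core_ep A] is the orthogonal projector onto the
    range of [A ^+ k].  The powers of [A] in the matrix
    [M = (A ^+ k)^t* *m A ^+ m.+1 *m mpinv A], whose null space is the range of
    [B], cancel the powers of the core-EP inverse in [X] and leave this
    projector, which [(A ^+ k)^t*] absorbs.  Hence [M *m (A *m X) = M], that is,
    [M] annihilates [1%:M - A *m X].  The off-diagonal block in the first row
    then vanishes, as [(1%:M - A *m X) *m A = A *m (1%:M - X *m A)]. *)

(** For any inner inverse [G] of [B], the product [B *m G] is a projector onto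
    the range of [B]. *)
Lemma mulmx_inner_inverse_range (F : fieldType) m n p (B : 'M[F]_(m, n))
    (G : 'M[F]_(n, m)) (Z : 'M[F]_(m, p)) :
  B *m G *m B = B -> (forall y : 'cV_p, mxrange B (Z *m y)) ->
  B *m G *m Z = Z.
Proof.
move=> BGB ZB; apply/matrixP => i j.
suff : col j (B *m G *m Z) = col j Z by move=> /colP/(_ i); rewrite !mxE.
have [x Zx] := ZB (delta_mx j 0).
by rewrite !colE -mulmxA Zx mulmxA BGB.
Qed.

Lemma mulmx_mpinv_row_free (C : numClosedFieldType) m n (A : 'M[C]_(m, n)) :
  row_free A -> A *m mpinv A = 1%:M.
Proof.
move=> fA; have /and4P[/eqP AGA _ _ _] := mpinvP A.
by apply: (row_free_inj fA); rewrite AGA mul1mx.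
Qed.

Section WeakGroupMP.

Variables (C : numClosedFieldType) (n : nat) (A : 'M[C]_n).
Let Ak := A ^+ mxindex A.

Lemma core_ep_factor : core_ep A = Ak *m (drazin A *m mpinv Ak).
Proof.
have /and3P[_ _ /eqP AD] := drazinP A.
have cDAk : drazin A *m Ak = Ak *m drazin A by apply: commrX; exact/esym.
by rewrite /core_ep cDAk mulmxA.
Qed.

Lemma mulmx_core_ep : A *m core_ep A = Ak *m mpinv Ak.
Proof.
have /and3P[/eqP DP _ _] := drazinP A.
by rewrite core_ep_factor !mulmxA {1}/Ak !mulmxE -exprS -mulmxE DP.
Qed.

(** The projector [Ak *m mpinv Ak] is Hermitian, so it can be moved through the
    conjugate transpose of [Ak *m mpinv Ak *m Ak = Ak]. *)
Lemma trmxC_mul_core_ep : Ak^t* *m (A *m core_ep A) = Ak^t*.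
Proof.
have /and4P[/eqP AGA _ /eqP hAG _] := mpinvP Ak.
by rewrite mulmx_core_ep -[in RHS]AGA [in RHS]trmxC_mul hAG.
Qed.

Variable m : nat.
Let X := m_weak_group_mp m A.

(** The defining equations have a unique solution, and this product satisfies
    them. *)
Lemma m_weak_group_mp_eq : X = m_weak_group m A *m A *m mpinv A.
Proof.
exact: m_weak_group_mp_unique (m_weak_group_mpP m A) (m_weak_group_mpE m A).
Qed.

Lemma m_weak_group_mp_null p (N : 'M[C]_(p, n)) : N *m Ak = 0 -> N *m X = 0.
Proof.
move=> NAk; rewrite m_weak_group_mp_eq /m_weak_group exprS -mulmxE.
by rewrite core_ep_factor !mulmxA NAk !mul0mx.
Qed.

(** The [mpinv A] that ends [M] disappears between the last factor of
    [A ^+ m.+1] and the [A] of [A *m X], as [A *m mpinv A *m A = A]; then [mul_core_epX] cancels the powers. *)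
Lemma m_weak_group_mp_absorb (M := Ak^t* *m A ^+ m.+1 *m mpinv A) :
  M *m (A *m X) = M.
Proof.
have /and4P[/eqP AGA _ _ _] := mpinvP A.
have powA : A ^+ m.+1 *m mpinv A *m A = A ^+ m.+1.
  by rewrite exprSr -mulmxE -!mulmxA (mulmxA A) AGA.
have powX : A ^+ m.+1 *m X = A *m core_ep A *m (A ^+ m.+1 *m mpinv A).
  rewrite m_weak_group_mp_eq /m_weak_group !mulmxA mul_core_epX.
  by rewrite [in RHS]exprSr -mulmxE !mulmxA.
rewrite /M -!mulmxA (mulmxA (mpinv A)) (mulmxA (A ^+ m.+1)).
by rewrite (mulmxA (A ^+ m.+1)) powA powX (mulmxA (Ak^t*)) trmxC_mul_core_ep.
Qed.

End WeakGroupMP.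

Theorem theorem6p2 (R : realType) (n k t m : nat) (A : 'M[R[i]]_n)
    (B : 'M[R[i]]_(n, n - t)) (C : 'M[R[i]]_(n - t, n))
    (index_A : mxindex A = k) (rank_Ak : \rank (A ^+ k) = t) (m_gt0 : (0 < m)%N)
    (rank_B : \rank B = (n - t)%N) (rank_C : \rank (C^t*) = (n - t)%N)
    (range_B : mxrange B = mxnull ((A ^+ k)^t* *m A ^+ m.+1 *m mpinv A))
    (null_C : mxnull C = mxrange (A ^+ k)) :
  let K := block_mx A B C 0 in
  let X := m_weak_group_mp m A in
  K \in unitmx /\
  invmx K = block_mx X                             ((1%:M - X *m A) *m mpinv C)
                     (mpinv B *m (1%:M - A *m X))
                     (mpinv B *m (A *m X *m A - A) *m mpinv C).
Proof.
move=> K X; set Y := (Y in invmx K = Y).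
have /and4P[/eqP BGB _ _ _] := mpinvP B.
have fC : row_free C by move: rank_C; rewrite mxrank_map mxrank_tr => /eqP.
have CX : C *m X = 0.
  apply: m_weak_group_mp_null; rewrite index_A.
  apply/matrixP => i j.
  suff : col j (C *m A ^+ k) = 0 by move=> /colP/(_ i); rewrite !mxE.
  rewrite colE -mulmxA.
  by have : mxnull C (A ^+ k *m delta_mx j 0) by rewrite null_C; eexists.
have BX : B *m mpinv B *m (1%:M - A *m X) = 1%:M - A *m X.
  apply: mulmx_inner_inverse_range BGB _ => y.
  rewrite range_B /mxnull /= mulmxA mulmxBr mulmx1.
  by rewrite -index_A m_weak_group_mp_absorb subrr mul0mx.
have XA : A *m X *m A - A = - ((1%:M - A *m X) *m A).
  by rewrite mulmxBl mul1mx opprB.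
have AX : A *m (1%:M - X *m A) = (1%:M - A *m X) *m A.
  by rewrite mulmxBr mulmxBl mulmx1 mul1mx mulmxA.
have KY : K *m Y = 1%:M.
  rewrite mulmx_block !mul0mx !addr0 [RHS]scalar_mx_block; congr block_mx.
  - by rewrite mulmxA BX addrC subrK.
  - rewrite !mulmxA -mulmxDl XA mulmxN [B *m mpinv B *m _]mulmxA BX.
    by rewrite AX subrr mul0mx.
  - exact: CX.
  - rewrite mulmxA mulmxBr mulmx1 mulmxA CX mul0mx subr0.
    exact: mulmx_mpinv_row_free.
have [uK _] := mulmx1_unit KY; split => //.
by rewrite -[RHS](mulKmx uK) KY mulmx1.
Qed.
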